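(* Let $N\ge 1$, let $(a,A)\in Z_N$ and let $(b,B)=\Omega(a,A)$. Then the following identities hold: $$\sum_{k=1}^N A_k=\sum_{k=1}^N B_k,$$ $$\frac12\sum_{k=1}^N\frac{A_k}{a_k}=\sum_{k=1}^N b_k,$$ $$\sum_{j,k=1}^N\frac{A_jA_k}{(a_j+a_k)^2}=\sum_{k=1}^N b_k^2.$$
   Context: Let $N\ge 1$ be a natural number. $Z_N$ denotes the set of all pairs $(a,A)$ where $a=(a_1,\dots,a_N)$ consists of distinct positive real numbers listed in increasing order, $0<a_1<a_2<\dots<a_N$, and $A=(A_1,\dots,A_N)$ consists of positive real numbers (in no particular order, not necessarily distinct). For $(a,A)\in Z_N$, the weighted Cauchy matrix is the $N\times N$ matrix $$\mathcal{C}_{a,A}=\left\{\frac{\sqrt{A_jA_k}}{a_k+a_j}\right\}_{j,k=1}^N,$$ and $v_A=(\sqrt{A_1},\dots,\sqrt{A_N})\in\mathbb{C}^N$. The matrix $\mathcal{C}_{a,A}$ is positive definite and $v_A$ is a cyclic vector for it (the vectors $\mathcal{C}_{a,A}^n v_A$, $n\ge 0$, span $\mathbb{C}^N$), so $\mathcal{C}_{a,A}$ has $N$ distinct positive eigenvalues. The spectral map $\Omega:Z_N\to Z_N$ is defined by $\Omega(a,A)=(b,B)$, where $b=(b_1,\dots,b_N)$ are the eigenvalues of $\mathcal{C}_{a,A}$ listed in increasing order, and $B=(B_1,\dots,B_N)$ with $B_k=|\langle v_A,f_k\rangle|^2$, where $f_k$ is an eigenvector of $\mathcal{C}_{a,A}$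 for the eigenvalue $b_k$, normalised to have Euclidean norm $1$, and $\langle\cdot,\cdot\rangle$ is the standard Euclidean inner product on $\mathbb{C}^N$. ($B_k$ does not depend on the choice of $f_k$, and $B_k>0$.) *)

(* Defs.v *)
From HB Require Import structures.
From mathcomp Require Import all_boot all_order all_algebra.
From mathcomp Require Import sesquilinear spectral.
From mathcomp Require Import complex.
From mathcomp Require Import boolp classical_sets reals.

Set Implicit Arguments.
Unset Strict Implicit.
Unset Printing Implicit Defensive.

Import Order.TTheory GRing.Theory Num.Theory.
Local Open Scope ring_scope.
Local Open Scope complex_scope.

Definition in_Z (R : realType) (N : nat) (x : 'rV[R]_N * 'rV[R]_N) : bool :=
  [&& [forall i, 0 < x.1 0 i],
      [forall i : 'I_N, forall j : 'I_N, (i < j)%N ==> (x.1 0 i < x.1 0 j)]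
    & [forall i, 0 < x.2 0 i]].

Definition Z (R : realType) (N : nat) := {x : 'rV[R]_N * 'rV[R]_N | in_Z x}.

Definition nodes (R : realType) (N : nat) (X : Z R N) (k : 'I_N) : R :=
  (sval X).1 0 k.

Definition weights (R : realType) (N : nat) (X : Z R N) (k : 'I_N) : R :=
  (sval X).2 0 k.

Definition cauchy_mx (R : realType) (N : nat) (X : Z R N) : 'M[R[i]]_N :=
  \matrix_(j, k)
    (Num.sqrt (weights X j * weights X k) / (nodes X k + nodes X j))%:C.

Definition weight_vec (R : realType) (N : nat) (X : Z R N) : 'rV[R[i]]_N :=
  \row_k (Num.sqrt (weights X k))%:C.

(* [f] is an eigenvector in the usual sense of acting on columns, whence the
   transpose: vectors are rows here because [dotmx] is defined on rows. *)
Definition unit_eigenvector (R : realType) (N : nat) (M : 'M[R[i]]_N)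
    (l : R[i]) (f : 'rV[R[i]]_N) : Prop :=
  M *m f^T = l *: f^T /\ sqrtC (dotmx f f) = 1.

(* The nodes of [Y] are strictly increasing since [Y : Z R N], so the first
   condition says that they list all eigenvalues in increasing order. *)
Definition spectral_data (R : realType) (N : nat) (X Y : Z R N) : Prop :=
  (forall l : R[i],
     eigenvalue (cauchy_mx X) l <-> exists k, l = (nodes Y k)%:C) /\
  (exists f : 'I_N -> 'rV[R[i]]_N, forall k,
     unit_eigenvector (cauchy_mx X) (nodes Y k)%:C (f k) /\
     (weights Y k)%:C = `|dotmx (weight_vec X) (f k)| ^+ 2).

(* The unique [Y] with [spectral_data X Y]; the default value [X] of [xget]
   is never used, as such a [Y] always exists. *)
Definition Omega (R : realType) (N : nat) (X : Z R N) : Z R N :=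
  xget X [set Y | spectral_data X Y]%classic.

(* Main.v *)
(* With D = diag(a) and v = v_A, the matrix C = C_{a,A} satisfies the Lyapunov
   equation C D + D C = v v^T. For a unit eigenvector f of eigenvalue b it gives
   2 b <D f, f> = |<v, f>|^2, so b >= 0, and b = 0 exactly when f is orthogonal
   to v. The kernel of C is then D-stable, hence spanned by coordinate vectors,
   hence zero: all b are positive, no eigenvector is orthogonal to v, and all
   eigenvalues are simple. So the data defining Omega exist, and the three
   identities compute |v|^2, tr C and tr C^2 in an orthonormal eigenbasis. *)
Require Import Defs.
From mathcomp Require Import all_boot all_order all_algebra.
From mathcomp Require Import reals.
From mathcomp Require Import all_fingroup sesquilinear spectral complex classical_sets.
From mathcomp Require Import ring.

Import Order.TTheory GRing.Theory Num.Theory.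
Local Open Scope ring_scope.
Local Open Scope sesquilinear_scope.

(** * Hermitian products of row vectors *)

Lemma dotmx_mulr (C : numClosedFieldType) n (M : 'M[C]_n) (f g : 'rV[C]_n) :
  dotmx f (g *m M) = dotmx (f *m M^t*) g.
Proof. by rewrite !dotmxE trmx_mul map_mxM mulmxA. Qed.

Lemma dotmx_conj (C : numClosedFieldType) n (f g : 'rV[C]_n) :
  dotmx f g = (dotmx g f)^*.
Proof. by rewrite hermC expr0 mul1r. Qed.

Lemma row_diag_mul (K : pzSemiRingType) m n (d : 'rV[K]_m) (Q : 'M[K]_(m, n)) k :
  row k (diag_mx d *m Q) = d 0 k *: row k Q.
Proof. by apply/rowP => j; rewrite mul_diag_mx !mxE. Qed.

(** * Consequences of a unitary diagonalization *)

Section UnitaryDiagonalization.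
Context (C : numClosedFieldType) (n : nat).
Context (M Q : 'M[C]_n) (d : 'rV[C]_n).
Hypotheses (Q_unitary : Q \is unitarymx) (QM : Q *m M = diag_mx d *m Q).

Let QQt : Q *m Q^t* = 1%:M. Proof. exact/unitarymxP. Qed.
Let QtQ : Q^t* *m Q = 1%:M. Proof. exact: mulmx1C. Qed.

Let M_diag : M = Q^t* *m diag_mx d *m Q.
Proof. by rewrite -mulmxA -QM mulmxA QtQ mul1mx. Qed.

Lemma unitary_diag_trace : \tr M = \sum_k d 0 k.
Proof. by rewrite M_diag mxtrace_mulC mulmxA QQt mul1mx mxtrace_diag. Qed.

(** The coordinates of [v] in the orthonormal rows of [Q] are the entries of [v *m Q^t*], and a
    unitary matrix preserves norms. *)
Lemma unitary_parseval (v : 'rV[C]_n) :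
  \sum_k `|dotmx v (row k Q)| ^+ 2 = dotmx v v.
Proof.
have dE k : dotmx v (row k Q) = (v *m Q^t*) 0 k.
  by rewrite dotmxE !mxE; apply: eq_bigr => j _; rewrite !mxE.
transitivity (dotmx (v *m Q^t*) (v *m Q^t*)).
  rewrite dotmxE mxE; apply: eq_bigr => k _.
  by rewrite dE normCK !mxE.
by rewrite dotmx_mulr trmxCK -mulmxA QtQ mulmx1.
Qed.

Lemma unitary_diag_eigenvalue (l : C) :
  eigenvalue M l <-> exists k, l = d 0 k.
Proof.
split=> [/eigenvalueP[u uM u0]|[k ->]].
  (* In the basis of rows of [Q], [u] becomes an eigenvector of the diagonal matrix; any nonzero
     coordinate [k] of it forces [l = d 0 k]. *)
  have : (u *m Q^t*) *m diag_mx d = l *: (u *m Q^t*).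
    by rewrite scalemxAl -uM M_diag -!mulmxA QQt mulmx1.
  have /rV0Pn[k wk] : u *m Q^t* != 0.
    by apply: contraNneq u0 => w0; rewrite -[u]mulmx1 -QtQ mulmxA w0 mul0mx.
  move/rowP/(_ k); rewrite mul_mx_diag !mxE => lE; exists k.
  move: wk; rewrite mxE => wk.
  by apply: (mulfI wk); rewrite lE mulrC.
apply/eigenvalueP; exists (row k Q).
  by rewrite -row_mul QM row_diag_mul.
apply: contraTneq (oner_neq0 C) => Q0; rewrite negbK.
have /matrixP/(_ k k) := QQt; rewrite [RHS]mxE eqxx mulr1n => <-.
rewrite mxE big1 // => j _.
by have /rowP/(_ j) := Q0; rewrite !mxE => ->; rewrite mul0r.
Qed.

End UnitaryDiagonalization.

(** The same [Q] diagonalizes [M *m M], with the squares of the [d 0 k] on the diagonal. *)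
Lemma unitary_diag_trace_sqr (C : numClosedFieldType) n (M Q : 'M[C]_n)
    (d : 'rV[C]_n) :
  Q \is unitarymx -> Q *m M = diag_mx d *m Q ->
  \tr (M *m M) = \sum_k d 0 k ^+ 2.
Proof.
move=> Qu QM; rewrite (unitary_diag_trace _ _ _ Q (\row_k d 0 k ^+ 2)) //.
  by apply: eq_bigr => k _; rewrite mxE.
by rewrite mulmxA QM -mulmxA QM mulmxA mulmx_diag; congr (diag_mx _ *m _).
Qed.

(** * Spectral theory of weighted Cauchy matrices *)

(** Here [v] holds the square roots of the weights, so no root of a product appears. *)
Definition weighted_cauchy (C : numClosedFieldType) n (a v : 'rV[C]_n) : 'M[C]_n :=
  \matrix_(j, k) (v 0 j * v 0 k / (a 0 k + a 0 j)).

Arguments weighted_cauchy {C n} a v.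

Section WeightedCauchy.
Context (C : numClosedFieldType) (n : nat) (a v : 'rV[C]_n).
Hypotheses (a_gt0 : forall i, 0 < a 0 i) (v_gt0 : forall i, 0 < v 0 i).
Hypothesis a_inj : injective (a 0).

Local Notation M := (weighted_cauchy a v).
Local Notation D := (diag_mx a).

Let asum_neq0 j k : a 0 k + a 0 j != 0.
Proof. by rewrite gt_eqF // addr_gt0. Qed.

Lemma weighted_cauchy_sym : M^T = M.
Proof. by apply/matrixP => j k; rewrite !mxE mulrC [a 0 k + _]addrC; ring. Qed.

Lemma weighted_cauchy_realmx : M \is a mxOver Num.real.
Proof.
apply/mxOverP => j k; rewrite mxE ger0_real //.
by rewrite divr_ge0 ?addr_ge0 ?mulr_ge0 // ltW.
Qed.

Lemma weighted_cauchy_adj : M^t* = M.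
Proof. by rewrite weighted_cauchy_sym realmxC // weighted_cauchy_realmx. Qed.

(** The left side multiplies entry [(j, k)] of [M] by [a 0 k + a 0 j], which cancels the
    denominator. *)
Lemma weighted_cauchy_lyapunov : M *m D + D *m M = v^T *m v.
Proof.
apply/matrixP => j k; rewrite mul_mx_diag mul_diag_mx !mxE big_ord1 !mxE.
by field.
Qed.

(** Pair both sides of the Lyapunov equation with [f]. Each term on the left contributes
    [l * dotmx (f *m D) f], the second one because [M] is self-adjoint and [l] real; the rank-one
    right side gives the square. *)
Lemma weighted_cauchy_lyapunov_eigen (f : 'rV[C]_n) l :
  l \is Num.real -> f *m M = l *: f ->
  l *+ 2 * dotmx (f *m D) f = `|dotmx v f| ^+ 2.
Proof.
move=> /CrealP lR fM.
have vt : v^t* = v^T.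
  by apply/colP => i; rewrite !mxE conj_Creal // ger0_real // ltW.
transitivity (dotmx (f *m (M *m D + D *m M)) f).
  rewrite mulmxDr linearDl /= !mulmxA fM -scalemxAl linearZl_LR /=.
  by rewrite -weighted_cauchy_adj -dotmx_mulr fM linearZr_LR /= lR mulr2n mulrDl.
rewrite weighted_cauchy_lyapunov dotmxE normCK -(dotmx_conj _ _ f v) !dotmxE vt.
by rewrite mulmxA -mulmxA [LHS]mxE big_ord1 mulrC.
Qed.

Lemma weighted_dot_gt0 (f : 'rV[C]_n) : f != 0 -> 0 < dotmx (f *m D) f.
Proof.
move=> /rV0Pn[i fi]; rewrite dotmxE mxE (bigD1 i) //= mul_mx_diag.
have E j : (\matrix_(i0, j0) (f i0 j0 * a 0 j0)) 0 j * (f ^t*) j 0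
   = a 0 j * `|f 0 j| ^+ 2 by rewrite !mxE normCK; ring.
rewrite E ltr_wpDr // ?sumr_ge0 //; last first.
  by rewrite mulr_gt0 // exprn_gt0 // normr_gt0.
by move=> j _; rewrite E mulr_ge0 ?exprn_ge0 // ltW.
Qed.

(* An element of the kernel is orthogonal to [v], so by the Lyapunov identity
   the kernel is stable under [D]; the [a_i] being distinct, polynomials in [D]
   isolate each coordinate, and the diagonal of [M] does not vanish. *)
Lemma weighted_cauchy_ker (f : 'rV[C]_n) : f *m M = 0 -> f = 0.
Proof.
have kerD (g : 'rV[C]_n) : g *m M = 0 -> g *m D *m M = 0.
  move=> gM.
  have := weighted_cauchy_lyapunov_eigen g 0 (real0 C).
  rewrite gM scale0r mul0rn mul0r => /(_ erefl)/esym/eqP.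
  rewrite expf_eq0 normr_eq0 /= => /eqP vg.
  have gv : g *m v^T = 0.
    apply/rowP => i; rewrite ord1 [RHS]mxE.
    move: vg; rewrite dotmx_conj => /eqP; rewrite conjC_eq0 dotmxE => /eqP <-.
    rewrite !mxE; apply: eq_bigr => k _.
    by rewrite !mxE conj_Creal // ger0_real // ltW.
  have := congr1 (mulmx g) weighted_cauchy_lyapunov.
  by rewrite mulmxDr !mulmxA gM gv !mul0mx add0r.
move=> fM.
have kerP (s : seq 'I_n) :
    (\row_k (f 0 k * \prod_(i <- s) (a 0 k - a 0 i))) *m M = 0.
  elim: s => [|i s IHs].
    rewrite -[RHS]fM; congr (_ *m _); apply/rowP => k.
    by rewrite mxE big_nil mulr1.
  set g := \row_k _ in IHs.
  have -> : \row_k (f 0 k * \prod_(j <- i :: s) (a 0 k - a 0 j))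
      = g *m D - a 0 i *: g.
    by apply/rowP => k; rewrite mul_mx_diag !mxE big_cons; ring.
  by rewrite mulmxBl -scalemxAl IHs scaler0 subr0 kerD.
apply/rowP => j; rewrite [RHS]mxE.
have /rowP/(_ j) := kerP [seq i <- index_enum 'I_n | i != j].
rewrite !mxE (bigD1 j) //= big1 ?addr0 => [|k kj]; last first.
  rewrite mxE (bigD1_seq k) /= ?mem_filter ?kj ?mem_index_enum ?filter_uniq ?index_enum_uniq //.
  by rewrite subrr mul0r mulr0 mul0r.
rewrite !mxE => /eqP; rewrite !mulf_eq0 invr_eq0 (negPf (asum_neq0 _ _)).
rewrite (gt_eqF (v_gt0 j)) !orbF => /orP[/eqP //|].
rewrite prodf_seq_eq0 => p0; case/hasP: p0 => i; rewrite mem_filter => /andP[ij _] /=.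
by rewrite subr_eq0 => /eqP/a_inj ji; rewrite ji eqxx in ij.
Qed.

(** If [f] were orthogonal to [v], the Lyapunov identity and positivity of [D] would force [l = 0],
    but the kernel is trivial. *)
Lemma weighted_cauchy_cyclic (f : 'rV[C]_n) l :
  l \is Num.real -> f *m M = l *: f -> f != 0 -> dotmx v f != 0.
Proof.
move=> lR fM f0; apply: contra_neq f0 => vf.
have := weighted_cauchy_lyapunov_eigen f l lR fM.
rewrite vf normr0 expr0n /= => /eqP; rewrite mulf_eq0 mulrn_eq0 /=.
case/orP => /eqP E.
  by apply: weighted_cauchy_ker; rewrite fM E scale0r.
by apply/eqP; apply: contra_eqT E => f0; rewrite gt_eqF // weighted_dot_gt0.
Qed.

Lemma weighted_cauchy_eigen_gt0 (f : 'rV[C]_n) l :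
  l \is Num.real -> f *m M = l *: f -> f != 0 -> 0 < l.
Proof.
move=> lR fM f0.
have : 0 < l *+ 2 * dotmx (f *m D) f.
  rewrite (weighted_cauchy_lyapunov_eigen f l) //.
  by rewrite exprn_gt0 // normr_gt0 (weighted_cauchy_cyclic f l).
by rewrite pmulr_lgt0 ?weighted_dot_gt0 // pmulrn_lgt0.
Qed.

(* Two independent eigenvectors for the same eigenvalue would have a nonzero
   combination orthogonal to the cyclic vector [v]. *)
Lemma weighted_cauchy_simple (f g : 'rV[C]_n) l :
  l \is Num.real -> f *m M = l *: f -> g *m M = l *: g ->
  dotmx f g = 0 -> f != 0 -> g = 0.
Proof.
move=> lR fM gM fg f0; apply/eqP; apply: contraTT isT => g0.
have vg := weighted_cauchy_cyclic g l lR gM g0.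
have gv : dotmx g v != 0 by rewrite dotmx_conj conjC_eq0.
pose c := dotmx f v / dotmx g v.
have hv : dotmx v (f - c *: g) = 0.
  by rewrite dotmx_conj linearBl linearZl_LR /= divfK // subrr conjC0.
have hM : (f - c *: g) *m M = l *: (f - c *: g).
  by rewrite mulmxBl -scalemxAl fM gM scalerBr !scalerA [c * l]mulrC.
have h0 : f - c *: g = 0.
  apply/eqP; apply: contra_eqT hv => h0.
  exact: (weighted_cauchy_cyclic _ l).
move: h0 => /eqP; rewrite subr_eq0 => /eqP fE.
move: fg; rewrite fE linearZl_LR /= => /eqP; rewrite mulf_eq0.
rewrite [dotmx g g == 0]gt_eqF ?dotmx_is_dotmx // orbF => /eqP c0.
by rewrite fE c0 scale0r eqxx in f0.
Qed.

Lemma weighted_cauchy_diagonalization :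
  exists (Q : 'M[C]_n) (d : 'rV[C]_n),
    [/\ Q \is unitarymx, Q *m M = diag_mx d *m Q, injective (d 0),
        forall k, 0 < d 0 k & forall k, dotmx v (row k Q) != 0].
Proof.
have Mherm : M \is hermsymmx.
  by apply/is_hermitianmxP; rewrite expr0 scale1r weighted_cauchy_adj.
have dR := hermitian_spectral_diag_real Mherm.
have /orthomx_spectralP ME := hermitian_normalmx Mherm.
have Qu := spectral_unitarymx M.
set Q := spectralmx M in ME Qu; set d := spectral_diag M in dR ME.
have QM : Q *m M = diag_mx d *m Q.
  by rewrite [in LHS]ME -mulmxA mulKVmx // unitarymx_unit.
have rowM k : row k Q *m M = d 0 k *: row k Q.
  by rewrite -row_mul QM row_diag_mul.
have dkR k : d 0 k \is Num.real by move/mxOverP: dR.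
have dot i j := row_unitarymxP Qu i j.
have row0 k : row k Q != 0.
  apply: contraTneq (oner_neq0 C) => r0.
  by have := dot k k; rewrite eqxx mulr1n r0 dotmxE mul0mx mxE => <-; rewrite eqxx.
exists Q, d; split => //.
(* A repeated eigenvalue would have two orthogonal nonzero eigenvectors, against simplicity. *)
- move=> i j dij; apply: contraTeq (row0 j) => ij; rewrite negbK.
  apply/eqP; apply: (weighted_cauchy_simple (row i Q) _ (d 0 i)) => //.
    by rewrite dij.
  by rewrite dot (negPf ij).
- by move=> k; apply: (weighted_cauchy_eigen_gt0 (row k Q)).
- by move=> k; apply: (weighted_cauchy_cyclic _ (d 0 k)).
Qed.

End WeightedCauchy.

(** * The spectral map on [Z R N] *)

Section SpectralMap.
Context (R : realType) (N : nat).
Local Open Scope complex_scope.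

Definition complex_nodes (X : Z R N) : 'rV[R[i]]_N := \row_k (nodes X k)%:C.

Lemma nodes_gt0 (X : Z R N) k : 0 < nodes X k.
Proof. by case/and3P: (svalP X) => /forallP/(_ k). Qed.

Lemma weights_gt0 (X : Z R N) k : 0 < weights X k.
Proof. by case/and3P: (svalP X) => _ _ /forallP/(_ k). Qed.

Lemma nodes_inj (X : Z R N) : injective (nodes X).
Proof.
case/and3P: (svalP X) => _ /forallP inc _ j k jk.
have lt_nodes (i i' : 'I_N) : (i < i')%N -> nodes X i < nodes X i'.
  by move: (inc i) => /forallP/(_ i')/implyP.
apply/val_inj; case: (ltngtP j k) => // /lt_nodes; by rewrite jk ltxx.
Qed.

Lemma complex_nodes_inj (X : Z R N) : injective (complex_nodes X 0).
Proof. by move=> j k; rewrite !mxE => /complexI/nodes_inj. Qed.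

Lemma complex_nodes_gt0 (X : Z R N) k : 0 < complex_nodes X 0 k.
Proof. by rewrite mxE ltcR nodes_gt0. Qed.

Lemma weight_vec_gt0 (X : Z R N) k : 0 < weight_vec X 0 k.
Proof. by rewrite mxE ltcR sqrtr_gt0 weights_gt0. Qed.

Lemma cauchy_mxE (X : Z R N) :
  cauchy_mx X = weighted_cauchy (complex_nodes X) (weight_vec X).
Proof.
apply/matrixP => j k; rewrite !mxE sqrtrM ?ltW ?weights_gt0 //.
by rewrite fmorph_div rmorphM rmorphD.
Qed.

Lemma cauchy_mx_sym (X : Z R N) : (cauchy_mx X)^T = cauchy_mx X.
Proof. by rewrite cauchy_mxE weighted_cauchy_sym. Qed.

(** The matrix is symmetric, so transposing turns column eigenvectors into the row eigenvectors used
    above. *)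
Lemma unit_eigenvectorP (X : Z R N) l (f : 'rV[R[i]]_N) :
  unit_eigenvector (cauchy_mx X) l f <->
  f *m cauchy_mx X = l *: f /\ dotmx f f = 1.
Proof.
have tr : cauchy_mx X *m f^T = (f *m cauchy_mx X)^T.
  by rewrite trmx_mul cauchy_mx_sym.
split=> [[eigf nf]|[eigf nf]]; split.
- by apply: trmx_inj; rewrite -tr eigf linearZ.
- by rewrite -[LHS]sqrtCK nf expr1n.
- by rewrite tr eigf linearZ.
- by rewrite nf sqrtC1.
Qed.

Lemma spectral_data_exists (X : Z R N) : exists Y, spectral_data X Y.
Proof.
have [Q [d [Qu QM d_inj d_gt0 vQ]]] :=
  weighted_cauchy_diagonalization _ _ _ _ (complex_nodes_gt0 X)
    (weight_vec_gt0 X) (@complex_nodes_inj X).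
rewrite -cauchy_mxE in QM.
have dE k : d 0 k = (complex.Re (d 0 k))%:C by rewrite RRe_real // gtr0_real.
pose t := [tuple complex.Re (d 0 k) | k < N].
(* The spectral theorem gives the eigenvalues in no particular order. The sorting permutation [p]
   also reorders the rows of [Q], keeping eigenvalues, eigenvectors and weights matched. *)
have [p sE] : exists p : 'S_N,
    sort <=%O t = [tuple tnth t (p i) | i < N].
  by apply/tuple_permP; rewrite perm_sort.
pose w k := `|dotmx (weight_vec X) (row (p k) Q)| ^+ 2.
have wE k : w k = (complex.Re (w k))%:C.
  by rewrite RRe_real // ger0_real // exprn_ge0.
pose b := \row_k complex.Re (d 0 (p k)); pose B := \row_k complex.Re (w k).
have bE k : b 0 k = nth 0 (sort <=%O t) k.
  by rewrite sE -tnth_nth !tnth_mktuple mxE.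
have Z_bB : in_Z (b, B).
  apply/and3P; split; apply/forallP => j.
  - by rewrite mxE -ltcR -dE.
  - apply/forallP => k; apply/implyP => jk; rewrite !bE.
    (* The sorted list is strictly increasing because the eigenvalues are distinct. *)
    have ts : sorted <%O (sort <=%O t).
      rewrite sort_lt_sorted map_inj_uniq ?enum_uniq // => i i' e.
      by apply: d_inj; rewrite dE e -dE.
    by rewrite lt_sorted_ltn_nth // inE size_sort size_tuple.
  - by rewrite mxE -ltcR -wE exprn_gt0 // normr_gt0.
exists (exist _ (b, B) Z_bB); split=> [l|].
  rewrite (unitary_diag_eigenvalue _ _ _ _ _ Qu QM); split=> -[k ->].
    exists (p^-1%g k); rewrite /nodes /= mxE permKV; exact: dE.
  by exists (p k); rewrite /nodes /= mxE -dE.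
exists (fun k => row (p k) Q) => k; split; last by rewrite /weights /= mxE -wE.
apply/unit_eigenvectorP; rewrite /nodes /= mxE -dE; split.
  by rewrite -row_mul QM row_diag_mul.
by have := row_unitarymxP Qu (p k) (p k); rewrite eqxx.
Qed.

Lemma Omega_spectral_data (X : Z R N) : spectral_data X (Omega X).
Proof. exact: (xgetPex X (spectral_data_exists X)). Qed.

(** The chosen unit eigenvectors are orthonormal, so stacking them as rows gives a unitary matrix
    that diagonalizes. *)
Lemma spectral_data_diagonalization (X Y : Z R N) : spectral_data X Y ->
  exists Q : 'M[R[i]]_N,
    [/\ Q \is unitarymx, Q *m cauchy_mx X = diag_mx (complex_nodes Y) *m Q
      & forall k, (weights Y k)%:C = `|dotmx (weight_vec X) (row k Q)| ^+ 2].
Proof.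
move=> [_ [f fP]]; pose Q : 'M[R[i]]_N := \matrix_k f k.
have fM k : f k *m cauchy_mx X = (nodes Y k)%:C *: f k.
  by have [/unit_eigenvectorP[]] := fP k.
exists Q; split.
- apply/row_unitarymxP => j k; rewrite !rowK; case: eqVneq => [->|jk].
    by have [/unit_eigenvectorP[]] := fP k.
  (* Evaluating this product in two ways gives [(b_j - b_k) <f_j, f_k> = 0], the nodes [b] of [Y]
     being real; they are distinct, whence orthogonality. *)
  have : dotmx (f j *m cauchy_mx X) (f k) = dotmx (f j) (f k *m cauchy_mx X).
    rewrite dotmx_mulr cauchy_mxE weighted_cauchy_adj //.
      exact: complex_nodes_gt0.
    exact: weight_vec_gt0.
  rewrite !fM linearZl_LR linearZr_LR /= conj_Creal; last by apply/complex_realP; eexists.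
  move/eqP; rewrite -subr_eq0 -mulrBl mulf_eq0 subr_eq0 => /orP[|/eqP //].
  by move=> /eqP/complexI/nodes_inj jk'; rewrite jk' eqxx in jk.
- apply/row_matrixP => k.
  by rewrite row_mul row_diag_mul rowK fM mxE.
- by move=> k; rewrite rowK; have [] := fP k.
Qed.

End SpectralMap.

(** * The three trace identities *)

Theorem theorem1p3 (R : realType) (N : nat) (hN : (1 <= N)%N)
    (aA bB : Z R N) (hOmega : bB = Omega aA) :
  let a := nodes aA in let A := weights aA in
  let b := nodes bB in let B := weights bB in
  [/\ \sum_(k < N) A k = \sum_(k < N) B k,
      1 / 2%:R * \sum_(k < N) (A k / a k) = \sum_(k < N) b k
    & \sum_(j < N) \sum_(k < N) (A j * A k / (a j + a k) ^+ 2)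
        = \sum_(k < N) b k ^+ 2].
Proof.
move=> a A b B.
have [Q [Qu QM BE]] : exists Q : 'M[R[i]]_N,
    [/\ Q \is unitarymx, Q *m cauchy_mx aA = diag_mx (complex_nodes R N bB) *m Q
      & forall k, ((B k)%:C)%C = `|dotmx (weight_vec aA) (row k Q)| ^+ 2].
  by apply: spectral_data_diagonalization; rewrite hOmega; exact: Omega_spectral_data.
have a_gt0 := nodes_gt0 R N aA : forall k, 0 < a k.
have A_gt0 := weights_gt0 R N aA : forall k, 0 < A k.
split; apply: complexI; rewrite ?rmorph_sum.
(* Both sums equal the squared norm of the weight vector, the second by Parseval. *)
- transitivity (dotmx (weight_vec aA) (weight_vec aA)).
    rewrite dotmxE mxE; apply: eq_bigr => k _; rewrite !mxE conj_Creal.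
      by rewrite -rmorphM -expr2 sqr_sqrtr // ltW.
    by apply/complex_realP; eexists.
  rewrite -(unitary_parseval _ _ _ Qu).
  by apply: eq_bigr => k _; exact/esym/BE.
(* The diagonal entries are [A k / (2 a k)]. *)
- transitivity (\tr (cauchy_mx aA)).
    rewrite mulr_sumr rmorph_sum; apply: eq_bigr => k _; rewrite mxE.
    rewrite -expr2 sqrtr_sqr gtr0_norm //; congr (_%:C)%C.
    by rewrite -/(A k) -/(a k); field; rewrite !gt_eqF // addr_gt0.
  by rewrite (unitary_diag_trace _ _ _ _ _ Qu QM); apply: eq_bigr => k _; rewrite mxE.
(* By symmetry the trace of the square is the sum of the squared entries, where the square roots
   disappear. *)
- transitivity (\tr (cauchy_mx aA *m cauchy_mx aA)).
    apply: eq_bigr => j _; rewrite mxE rmorph_sum; apply: eq_bigr => k _.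
    rewrite !mxE -rmorphM; congr (_%:C)%C.
    rewrite -/(A j) -/(A k) -/(a j) -/(a k) [A k * A j]mulrC [a j + a k]addrC.
    by rewrite mulrACA -expr2 sqr_sqrtr ?mulr_ge0 ?ltW // -invfM -expr2.
  rewrite (unitary_diag_trace_sqr _ _ _ _ _ Qu QM).
  by apply: eq_bigr => k _; rewrite mxE rmorphXn.
Qed.
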